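(* Let $F$ be a free nonabelian group (i.e. a free group of rank at least $2$, possibly infinite). Then there exists a finitely generated isolated subgroup $H$ of $F$ which is not separable in the class of nilpotent groups.
   Context: A subgroup $H$ of a group $G$ is isolated if for every $g \in G$ and every integer $n \geq 1$, $g^n \in H$ implies $g \in H$. Let $\mathcal{K}$ be a class of groups. A subgroup $H$ of a group $G$ is separable in the class $\mathcal{K}$ if for every element $g \in G \setminus H$ there is a homomorphism $\varphi$ of $G$ to some group in $\mathcal{K}$ such that $\varphi(g) \notin \varphi(H)$. *)

(* Defs.v *)
From mathcomp Require Import all_boot all_classical.

Set Implicit Arguments.
Unset Strict Implicit.
Unset Printing Implicit Defensive.

Local Open Scope classical_set_scope.
Local Open Scope group_scope.

(* Groups are the (possibly infinite) groupType's of mathcomp.boot.monoid,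
   subsets are classical sets.  Classically every type carries a choiceType
   structure, so groupType covers all groups. *)

Definition is_subgroup (G : groupType) (H : set G) : Prop :=
  H 1 /\ forall x y, H x -> H y -> H (x / y).

Definition generated (G : groupType) (S : set G) : set G :=
  smallest (@is_subgroup G) S.

Definition finitely_generated (G : groupType) (H : set G) : Prop :=
  exists2 S : set G, finite_set S & H = generated S.

Definition isolated (G : groupType) (H : set G) : Prop :=
  forall (g : G) (n : nat), (1 <= n)%N -> H (g ^+ n) -> H g.

Definition separable_in (K : groupType -> Prop) (G : groupType) (H : set G)
    : Prop :=
  forall g : G, ~ H g ->
    exists (Q : groupType) (phi : UMagmaMorphism.type G Q),
      K Q /\ ~ (phi @` H) (phi g).

(* @lower_central G n is the usual gamma_{n+1}(G): the numbering starts at 0. *)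
Fixpoint lower_central (G : groupType) (n : nat) : set G :=
  if n is m.+1 then
    generated [set [~ x, y] | x in @lower_central G m & y in [set: G]]
  else [set: G].

Definition nilpotent (G : groupType) : Prop :=
  exists n, @lower_central G n = [set 1].

(* F is free with basis B, by the universal property; only the values of f
   on B matter. *)
Definition free_on (F : groupType) (B : set F) : Prop :=
  forall (G : groupType) (f : F -> G),
    (exists phi : UMagmaMorphism.type F G, forall x, B x -> phi x = f x) /\
    (forall phi psi : UMagmaMorphism.type F G,
       (forall x, B x -> phi x = f x) -> (forall x, B x -> psi x = f x) ->
       forall x, phi x = psi x).

(* Main.v *)
(* Let a, b be two basis elements and H = <a, (b a) b (b a)^-1>.

   In a nilpotent group Q, any subgroup containing the images of the two
   generators of H contains the image of b, since H and <a, b> agree modulo each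
   term of the lower central series; but b is not in H.  So H is not separable.

   Membership in H is read off the Stallings graph of H: a reduced word lies in
   H iff it labels a loop at the base point.  If u c^n u^-1 is such a word, with
   c cyclically reduced and u c u^-1 not in H, then every power of c can be read
   from two distinct vertices.  The off-diagonal part of the fibre square of the
   graph is a union of paths of length 2, so no reduced word of length 3 can be
   read there, and H is isolated. *)

Require Import Defs.
From HB Require Import structures.
From mathcomp Require Import all_boot all_classical.

Set Implicit Arguments.
Unset Strict Implicit.
Unset Printing Implicit Defensive.

Local Open Scope classical_set_scope.
Local Open Scope group_scope.

(** * Subgroups, and the subgroup generated by a basis *)

Section Subgroups.

Variable G : groupType.
Implicit Types (S K : set G) (x y : G).

Lemma is_subgroupV K x : is_subgroup K -> K x -> K x^-1.
Proof. by case=> K1 KF Kx; rewrite -div1g; apply: KF. Qed.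

Lemma is_subgroupM K x y : is_subgroup K -> K x -> K y -> K (x * y).
Proof.
move=> hK Kx Ky; rewrite -(invgK y); case: (hK) => _; apply => //.
exact: is_subgroupV.
Qed.

Lemma is_subgroup_generated S : is_subgroup (generated S).
Proof.
split=> [K [[]] // | x y Sx Sy K KP].
by have [[_ KF] _] := KP; apply: KF; [apply: Sx | apply: Sy].
Qed.

Lemma sub_generated S : S `<=` generated S.
Proof. by move=> x Sx K [_]; apply. Qed.

Lemma generated_min S K : is_subgroup K -> S `<=` K -> generated S `<=` K.
Proof. by move=> hK SK x; apply. Qed.

Lemma is_subgroup_image (Q : groupType) (phi : UMagmaMorphism.type G Q) K :
  is_subgroup K -> is_subgroup (phi @` K).
Proof.
case=> K1 KF; split=> [|_ _ [x Kx <-] [y Ky <-]].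
  by exists 1 => //; exact: gmulf1.
by exists (x / y); [exact: KF | rewrite gmulfF].
Qed.

(** The proof is a parameter of the type, so that the group structure can be inferred from it. *)
Definition subgroup_of S of is_subgroup S : Type := set_type S.

Lemma is_subgroup_closed S : is_subgroup S -> group_closed (fun x => x \in S).
Proof.
case=> S1 SF; split; first exact/mem_set.
by move=> x y /set_mem Sx /set_mem Sy; apply/mem_set/SF.
Qed.

End Subgroups.

HB.instance Definition _ (G : groupType) (S : set G) (hS : is_subgroup S) :=
  SubChoice.copy (subgroup_of hS) (set_type S).
HB.instance Definition _ (G : groupType) (S : set G) (hS : is_subgroup S) :=
  SubChoice_isSubGroup.Build G (fun x => x \in S) (subgroup_of hS)
    (is_subgroup_closed hS).

(** The universal property yields a morphism from [F] to [S]; followed by the inclusion it fixes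
    [B], so by uniqueness it is the identity. *)
Lemma free_on_generates (F : groupType) (B S : set F) :
  free_on B -> is_subgroup S -> B `<=` S -> forall x, S x.
Proof.
move=> hB hS BS x.
pose f y : subgroup_of hS :=
  if pselect (S y) is left Sy then exist _ y (mem_set Sy) else 1.
have [[phi phiE] _] := hB (subgroup_of hS) f.
have [_ uniq_id] := hB F id.
pose psi : UMagmaMorphism.type F F := val \o phi.
have <- : psi x = x.
  rewrite (uniq_id psi idfun) // => y By /=; rewrite phiE // /f.
  by case: pselect => // -[]; exact: BS.
exact: set_mem (valP (phi x)).
Qed.

(** * Lower central series and subgroups of nilpotent groups *)

Section LowerCentral.

Variable Q : groupType.
Implicit Types (K : set Q) (x y : Q) (n : nat).

Lemma is_subgroup_lower_central n : is_subgroup (@lower_central Q n).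
Proof. by case: n => [|n] //=; exact: is_subgroup_generated. Qed.

Lemma lower_central_comm n x y :
  @lower_central Q n x -> @lower_central Q n.+1 [~ x, y].
Proof. by move=> Qx; apply: sub_generated; exists x => //; exists y. Qed.

Lemma lower_centralS n : @lower_central Q n.+1 `<=` @lower_central Q n.
Proof.
elim: n => [//|n IHn]; apply: generated_min.
  exact: is_subgroup_lower_central.
by move=> _ [x Qx [y _ <-]]; apply: lower_central_comm; exact: IHn.
Qed.

Lemma lower_centralJ n x y : @lower_central Q n x -> @lower_central Q n (x ^ y).
Proof.
move=> Qx; have -> : x ^ y = x * [~ x, y] by rewrite commgEl mulVKg.
apply: is_subgroupM => //; first exact: is_subgroup_lower_central.
by apply: lower_centralS; apply: lower_central_comm.
Qed.

(* By induction on n, y = k * z with k in K and z in the n-th term; conjugating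
   by z moves K only modulo the next term. *)
Lemma nilpotent_conj_mem K x y : nilpotent Q -> is_subgroup K ->
  K x -> K ((y * x) * y / (y * x)) -> K y.
Proof.
move=> [n Qn1] hK Kx Kyx.
suff : exists2 k, K k & @lower_central Q n (k^-1 * y).
  by rewrite Qn1 => -[k Kk /mulg1_eq]; rewrite invgK => <-.
elim: n {Qn1} => [|n [k Kk Qz]].
  by exists 1 => //; case: hK.
set z := k^-1 * y in Qz.
have yE : y = k * z by rewrite /z mulVKg.
pose d := ((y * x) * y / (y * x)) ^ k.
have Kd : K d.
  by rewrite /d conjgE; do ?apply: is_subgroupM => //; apply: is_subgroupV.
(* Conjugating by [k] and then [z] is conjugating by [y], which turns [(y * x) * y / (y * x)] into
   [x * y / x]. *)
have dE : (d ^ z) ^ x = y.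
  by rewrite /d -!conjgM mulgA -yE conjgE !gnorm.
clearbody d; exists (d ^ x).
  by rewrite conjgE; do ?apply: is_subgroupM => //; apply: is_subgroupV.
have -> : (d ^ x)^-1 * y = [~ d, z] ^ x.
  by rewrite commgEl conjMg conjVg dE.
(* Inverting the commutator puts [z], the entry known to lie in the [n]-th term, first. *)
apply: (@lower_centralJ n.+1); rewrite -invgR.
apply: (is_subgroupV (is_subgroup_lower_central n.+1)).
exact: lower_central_comm.
Qed.

End LowerCentral.

(** * The group of permutations of a type *)

Record permutation (X : Type) := Permutation {
  fwd : X -> X;
  bwd : X -> X;
  fwdK : cancel fwd bwd;
  bwdK : cancel bwd fwd }.

Lemma permutation_ext (X : Type) (p q : permutation X) :
  fwd p =1 fwd q -> p = q.
Proof.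
move=> /funext pq; have {}pqV : bwd p = bwd q.
  by apply/funext => x; rewrite -[LHS](fwdK q) -pq bwdK.
case: p q pq pqV => [f g fK gK] [f' g' fK' gK'] /= ff' gg'.
case: _ / ff' in fK' gK' *; case: _ / gg' in fK' gK' *.
by congr Permutation; apply: Prop_irrelevance.
Qed.

Section PermutationGroup.

Variable X : Type.
Implicit Types p q r : permutation X.

Definition permutation1 := @Permutation X id id (frefl _) (frefl _).
Definition permutationV p := Permutation (bwdK p) (fwdK p).
(** The right factor acts first, matching the [foldr] in [reduction]. *)
Definition permutationM p q :=
  Permutation (can_comp (fwdK p) (fwdK q)) (can_comp (bwdK q) (bwdK p)).

Lemma permutationA : associative permutationM.
Proof. by move=> p q r; apply: permutation_ext. Qed.
Lemma permutation1M : left_id permutation1 permutationM.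
Proof. by move=> p; apply: permutation_ext. Qed.
Lemma permutationM1 : right_id permutation1 permutationM.
Proof. by move=> p; apply: permutation_ext. Qed.
Lemma permutationVM : left_inverse permutation1 permutationV permutationM.
Proof. by move=> p; apply: permutation_ext => x; exact: fwdK. Qed.
Lemma permutationMV : right_inverse permutation1 permutationV permutationM.
Proof. by move=> p; apply: permutation_ext => x; exact: bwdK. Qed.

HB.instance Definition _ := gen_eqMixin (permutation X).
HB.instance Definition _ := gen_choiceMixin (permutation X).
HB.instance Definition _ := isGroup.Build (permutation X)
  permutationA permutation1M permutationM1 permutationVM permutationMV.

End PermutationGroup.

(** * Words, free reduction and cyclic reduction *)

Section Words.

Variable I : eqType.

(* (i, false) stands for the i-th generator and (i, true) for its inverse *)
Notation letter := (I * bool)%type.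
Implicit Types (l m : letter) (u v w : seq letter).

Definition linv l : letter := (l.1, ~~ l.2).

Lemma linvK : involutive linv.
Proof. by case=> i []. Qed.

Definition winv w := rev (map linv w).

Lemma winvK : involutive winv.
Proof. by move=> w; rewrite /winv map_rev revK mapK //; exact: linvK. Qed.

Definition noncancel l m := m != linv l.

Definition reduced w := sorted noncancel w.

Definition cancel_cons l w :=
  if w is m :: w' then if m == linv l then w' else l :: w else [:: l].

Definition reduction w := foldr cancel_cons [::] w.

Lemma reduced_cancel_cons l w : reduced w -> reduced (cancel_cons l w).
Proof.
case: w => [//|m w] /=; case: ifP => [_ /path_sorted // | ml mw].
by rewrite /reduced /= /noncancel ml.
Qed.

(** If [l] cancels the head [linv l] of [w], the rest of the reduced word [w] does not start with
    [l], so [linv l] is simply put back. *)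
Lemma cancel_consK l w :
  reduced w -> cancel_cons (linv l) (cancel_cons l w) = w.
Proof.
case: w => [_ | m w] /=; first by rewrite linvK eqxx.
case: ifP => [/eqP -> | _] /=; last by rewrite linvK eqxx.
by case: w => [//|m' w] /= /andP[/negPf ->].
Qed.

Lemma reduction_id w : reduced w -> reduction w = w.
Proof.
elim: w => [//|l [//|m w] IHw] /= /andP[lm mw].
by rewrite [cancel_cons m _]IHw //= (negPf lm).
Qed.

Lemma reduced_reduction w : reduced (reduction w).
Proof. by elim: w => //= l w; exact: reduced_cancel_cons. Qed.

(** The only new adjacent pair is the one where the two copies of [l :: w] meet. *)
Lemma reduced_insert p l w t : noncancel (last l w) l ->
  reduced (p ++ (l :: w) ++ t) -> reduced (p ++ (l :: w) ++ (l :: w) ++ t).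
Proof.
case: p => [|m p] wl;
  rewrite /reduced /= ?cat_path /= !cat_path /= wl ?cat_path.
  by case/andP=> -> ->.
by case/and4P=> -> -> -> ->.
Qed.

Lemma reduced_conj_pow u l w n : noncancel (last l w) l ->
  reduced (u ++ (l :: w) ++ winv u) ->
  reduced (u ++ flatten (nseq n.+1 (l :: w)) ++ winv u).
Proof.
move=> wl uwu; elim: n => [|n IHn]; first by rewrite /= cats0.
have := @reduced_insert u l w (flatten (nseq n (l :: w)) ++ winv u) wl.
by rewrite /= -!catA /= -?catA in IHn *; apply.
Qed.

Lemma reduced_flatten l w n : noncancel (last l w) l ->
  reduced (l :: w) -> reduced (flatten (nseq n (l :: w))).
Proof.
case: n => [//|n] wl lw.
by have := @reduced_conj_pow [::] l w n wl; rewrite /= !cats0; apply.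
Qed.

(** Strip the first and last letters as long as they are mutually inverse. *)
Lemma cyclic_reduction w : exists u c, w = u ++ c ++ winv u /\
  (if c is l :: c' then noncancel (last l c') l else True).
Proof.
elim: {w}_.+1 {-2}w (ltnSn (size w)) => [//|n IHn] [|l w] /= lewn.
  by exists [::], [::].
case: (lastP w) lewn => [_|v m].
  exists [::], [:: l]; split => //.
  by case: l => i [] /=; rewrite /noncancel /linv xpair_eqE eqxx.
rewrite size_rcons !ltnS => levn.
have [ml | ml] := boolP (l == linv m); last first.
  exists [::], (l :: rcons v m); rewrite cats0; split => //.
  by rewrite last_rcons.
have [u [c [-> cP]]] := IHn v (ltnW levn).
exists (l :: u), c; split=> //.
by rewrite /winv /= rev_cons -!rcons_cat (eqP ml) linvK.
Qed.

Section Evaluation.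

Variables (G : groupType) (e : I -> G).

Definition leval l := if l.2 then (e l.1)^-1 else e l.1.
Definition weval w := \prod_(l <- w) leval l.

Lemma weval_cons l w : weval (l :: w) = leval l * weval w.
Proof. exact: big_cons. Qed.

Lemma weval_cat u w : weval (u ++ w) = weval u * weval w.
Proof. exact: big_cat. Qed.

Lemma leval_inv l : leval (linv l) = (leval l)^-1.
Proof. by case: l => i []; rewrite /leval /= ?invgK. Qed.

Lemma weval_inv w : weval (winv w) = (weval w)^-1.
Proof.
elim: w => [|l w IHw]; first by rewrite /weval big_nil invg1.
rewrite /winv /= rev_cons -cats1 weval_cat IHw !weval_cons invgM leval_inv.
by rewrite /weval big_nil mulg1.
Qed.

Lemma weval_reduction w : weval (reduction w) = weval w.
Proof.
elim: w => [//|l w IHw] /=; rewrite weval_cons -{}IHw.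
case: (reduction w) => [|m u] /=; first by rewrite weval_cons.
case: eqP => [->|_]; last by rewrite weval_cons.
by rewrite weval_cons leval_inv mulVKg.
Qed.

Lemma weval_pow n w : weval (flatten (nseq n w)) = weval w ^+ n.
Proof.
elim: n => [|n IHn]; first by rewrite /weval big_nil.
by rewrite /= weval_cat IHn expgS.
Qed.

End Evaluation.

Definition reduced_word := {w : seq letter | reduced w}.

Definition reduced_word_cons l (w : reduced_word) : reduced_word :=
  exist (fun u => is_true (reduced u)) _ (reduced_cancel_cons l (valP w)).

Lemma reduced_word_consK l :
  cancel (reduced_word_cons l) (reduced_word_cons (linv l)).
Proof. by move=> w; apply: val_inj; apply: cancel_consK (valP w). Qed.

Lemma reduced_word_consVK l :
  cancel (reduced_word_cons (linv l)) (reduced_word_cons l).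
Proof. by move=> w; rewrite -{1}(linvK l) reduced_word_consK. Qed.

Definition letter_perm l : permutation reduced_word :=
  Permutation (@reduced_word_consK l) (@reduced_word_consVK l).

End Words.

(** * Reading words in the Stallings graph *)

Section StallingsGraph.

Variables (I : eqType) (i j : I).

Notation letter := (I * bool)%type.
Implicit Types (l m : letter) (w : seq letter) (u v : nat).

(* Stallings graph of <a, (b a) b (b a)^-1>: the vertices are 0 (the base
   point), 1, 2, and the edges are 0 -a-> 0, 0 -b-> 1, 1 -a-> 2, 2 -b-> 2. *)
Definition step v l : option nat := (
  if l.1 == i then
    match l.2, v with
    | _, 0 => Some 0 | false, 1 => Some 2 | true, 2 => Some 1 | _, _ => None
    end
  else if l.1 == j then
    match l.2, v with
    | _, 2 => Some 2 | false, 0 => Some 1 | true, 1 => Some 0 | _, _ => None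
    end
  else None)%N.

Fixpoint read v w : option nat :=
  if w is l :: w' then obind (read^~ w') (step v l) else Some v.

(** This expresses that the graph is folded: edges are deterministic in both directions. *)
Lemma step_inv v l u : step v l = Some u -> step u (linv l) = Some v.
Proof.
rewrite /step /=; case: eqP => _; last case: eqP => _ //.
  by case: l.2 v => [] [|[|[|v]]] //= [<-].
by case: l.2 v => [] [|[|[|v]]] //= [<-].
Qed.

Lemma read_cat v w1 w2 : read v (w1 ++ w2) = obind (read^~ w2) (read v w1).
Proof. by elim: w1 v => //= l w1 IHw v; case: (step v l) => /=. Qed.

Lemma read_catP v w1 w2 u : read v (w1 ++ w2) = Some u ->
  exists2 p, read v w1 = Some p & read p w2 = Some u.
Proof. by rewrite read_cat; case: (read v w1) => [p|] //= ?; exists p. Qed.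

Lemma read_inv v w u : read v w = Some u -> read u (winv w) = Some v.
Proof.
elim: w v => [|l w IHw] v /=; first by case=> ->.
case vl: (step v l) => [p|] //= /IHw pu.
by rewrite /winv /= rev_cons -cats1 read_cat pu /= (step_inv vl).
Qed.

Lemma read_reduction v w u : read v w = Some u -> read v (reduction w) = Some u.
Proof.
elim: w v => [//|l w IHw] v /=; case vl: (step v l) => [p|] //= /IHw.
case: (reduction w) => [|m r] /=; first by rewrite vl.
case: eqP => [-> | _]; last by rewrite /= vl.
by rewrite (step_inv vl).
Qed.

(* Off the diagonal, the fibre square of the graph is two copies of the path
   {0,1} -a-> {0,2} -b-> {1,2}; u + v identifies the pair {u,v}. *)
Lemma step_neq u v l u' v' : u <> v ->
  step u l = Some u' -> step v l = Some v' ->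
  u' <> v' /\
  [\/ [/\ l = (i, false), u + v = 1 & u' + v' = 2],
      [/\ l = (i, true), u + v = 2 & u' + v' = 1],
      [/\ l = (j, false), u + v = 2 & u' + v' = 3] |
      [/\ l = (j, true), u + v = 3 & u' + v' = 2]]%N.
Proof.
case: l => k s uv; rewrite /step /=.
case: eqP => [-> | _]; last case: eqP => [-> | //].
- case: s u v uv => [] [|[|[|u]]] [|[|[|v]]] //= _ [<-] [<-]; split => //;
  by [apply: Or41 | apply: Or42].
- case: s u v uv => [] [|[|[|u]]] [|[|[|v]]] //= _ [<-] [<-]; split => //;
  by [apply: Or43 | apply: Or44].
Qed.

(** A walk of three edges on a path with two edges must backtrack, and backtracking spells a
    cancelling pair of letters. *)
Lemma size_read_neq u v w : u <> v -> reduced w ->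
  read u w -> read v w -> (size w <= 2)%N.
Proof.
case: w => [//|l [//|m [//|k w]]] uv /and3P[lm mk _] /=.
case ul: (step u l) => [u1|] //=; case um: (step u1 m) => [u2|] //=.
case uk: (step u2 k) => [u3|] //= _.
case vl: (step v l) => [v1|] //=; case vm: (step v1 m) => [v2|] //=.
case vk: (step v2 k) => [v3|] //= _.
have [uv1 Hl] := step_neq uv ul vl.
have [uv2 Hm] := step_neq uv1 um vm.
have [_ Hk] := step_neq uv2 uk vk.
case: Hl Hm Hk lm mk => -[-> _ s1] [] [-> s1' s2] [] [-> s2' _];
  rewrite /noncancel /linv /= ?eqxx //; congruence.
Qed.

Lemma isolated_read (u : seq letter) l w n (p : nat) :
  noncancel (last l w) l -> reduced (u ++ (l :: w) ++ winv u) ->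
  read p (u ++ flatten (nseq n.+1 (l :: w)) ++ winv u) = Some p ->
  read p (u ++ (l :: w) ++ winv u) = Some p.
Proof.
(* Reading the final [winv u] backwards from [p] reads [u], so the power of [c] starts and ends at
   the same vertex [q]. *)
set c := l :: w => wl ucu /read_catP[q pu /read_catP[q' qc /read_inv]].
rewrite winvK pu => -[q'E]; rewrite -{}q'E in qc.
have qcn (m : nat) : read q (flatten (nseq (m * n.+1) c)) = Some q.
  by elim: m => [//|m IHm]; rewrite mulSn nseqD flatten_cat read_cat qc.
(* The [k]-th power of [c] is a prefix of the [k * n.+1]-th, which loops at [q]. *)
have readable k : read q (flatten (nseq k c)).
  have := qcn k; rewrite -(subnKC (leq_pmulr k (ltn0Sn n))) nseqD flatten_cat.
  by case/read_catP=> z ->.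
have: read q c by have := readable 1%N; rewrite /= cats0.
case qr: (read q c) => [r|] // _.
(* Either [c] is itself a loop at [q], or its cube, of length at least 3, is readable from both [q]
   and [r]. *)
have [qr'|/eqP neq_qr] := eqVneq q r.
  rewrite read_cat pu -[LHS]/(read q (c ++ winv u)) read_cat qr -qr'.
  exact: read_inv.
have redc : reduced (flatten (nseq 3 c)).
  apply: reduced_flatten => //; move: ucu; rewrite /reduced.
  by move=> /cat_sorted2[_ /cat_sorted2[]].
have r3 : read r (flatten (nseq 3 c)).
  have := readable 4.
  by rewrite -[flatten (nseq 4 c)]/(c ++ flatten (nseq 3 c)) read_cat qr.
have := size_read_neq neq_qr redc (readable 3%N) r3.
by rewrite size_flatten /shape map_nseq sumn_nseq /c /= mulSn.
Qed.

End StallingsGraph.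

(** * Normal forms in a free group *)

Section FreeGroup.

Variables (F : groupType) (B : set F).
Hypothesis hB : free_on B.

Notation ev := (weval (fun i : set_type B => val i)).
Notation lev := (leval (fun i : set_type B => val i)).

Lemma is_subgroup_weval : is_subgroup (range ev).
Proof.
split=> [|_ _ [u _ <-] [v _ <-]]; first by exists [::] => //; apply: big_nil.
by exists (u ++ winv v) => //; rewrite weval_cat weval_inv.
Qed.

Lemma weval_surj x : exists w, ev w = x.
Proof.
suff [w _ <-] : range ev x by exists w.
apply: free_on_generates hB is_subgroup_weval _ x => y By.
exists [:: (exist _ y (mem_set By), false)] => //.
by rewrite /weval big_seq1.
Qed.

(** Van der Waerden's argument: [F] acts on reduced words, basis elements acting by [cancel_cons],
    and [ev w] sends the empty word to [reduction w]. *)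
Lemma weval_eq_reduction u v : ev u = ev v -> reduction u = reduction v.
Proof.
pose f x : permutation (reduced_word (set_type B)) :=
  if pselect (B x) is left Bx then letter_perm (exist _ x (mem_set Bx), false)
  else 1.
have [[rho rhoE] _] := hB f.
have rhoB i : rho (val i) = letter_perm (i, false).
  case: i => x xB; rewrite rhoE /=; last exact: set_mem.
  rewrite /f; case: pselect => [Bx|[]]; last exact: set_mem.
  by rewrite (bool_irrelevance (mem_set Bx) xB).
pose one : reduced_word (set_type B) :=
  exist (fun u => is_true (reduced u)) [::] isT.
suff rhow w : val (fwd (rho (ev w)) one) = reduction w.
  by move=> uv; rewrite -!rhow uv.
elim: w => [|l w IHw]; first by rewrite /weval big_nil gmulf1.
rewrite weval_cons gmulfM /= -IHw.
by case: l => i [] /=; rewrite /leval /= ?gmulfV rhoB.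
Qed.

Lemma is_subgroup_read i j :
  is_subgroup [set ev w | w in [set w | read i j 0 w = Some 0]].
Proof.
split=> [|_ _ [u u0 <-] [v v0 <-]]; first by exists [::] => //; apply: big_nil.
exists (u ++ winv v); last by rewrite weval_cat weval_inv.
by rewrite /= read_cat u0 /= (read_inv v0).
Qed.

(** * The subgroup [H]: membership, isolation and images in nilpotent groups *)

Section TwoGenerators.

Variables (i j : set_type B).
Hypothesis neq_ij : i <> j.

Let a : F := val i.
Let b : F := val j.

(** Dense in the subgroup generated by [a] and [b]: both have the same image in every nilpotent
    group. *)
Definition dense_subgroup : set F := generated [set a; (b * a) * b / (b * a)].

Lemma dense_subgroup_read x :
  dense_subgroup x -> exists2 w, ev w = x & read i j 0 w = Some 0.
Proof.
suff H : dense_subgroup `<=` [set ev w | w in [set w | read i j 0 w = Some 0]].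
  by case/H=> w w0 wx; exists w.
have /eqP/negPf ji : j <> i by move/esym.
apply: generated_min (is_subgroup_read i j) _ => _ [->|->].
  exists [:: (i, false)]; last by rewrite /weval big_seq1.
  by rewrite /= /step /= eqxx.
(* This word visits the vertices 0, 1, 2, 2, 1, 0. *)
exists [:: (j, false); (i, false); (j, false); (i, true); (j, true)].
  by rewrite /= /step /=; do 5 rewrite ?ji ?eqxx /=.
by rewrite !weval_cons /weval big_nil /leval /= invgM mulg1 !mulgA.
Qed.

(** The product telescopes over the edges of the walk: an edge from [v] to [p] labelled [l]
    contributes [t v * lev l / t p], which is 1, a generator or the inverse of one. *)
Lemma read_dense_subgroup w :
  read i j 0 w = Some 0 -> dense_subgroup (ev w).
Proof.
(* t v is the label of a path from the base point to v *)
pose t v := if v is v'.+1 then if v' is _.+1 then b * a else b else 1.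
have hH : is_subgroup dense_subgroup by exact: is_subgroup_generated.
have Ha : dense_subgroup a by apply: sub_generated; left.
have Hb : dense_subgroup ((b * a) * b / (b * a)) by apply: sub_generated; right.
suff H v u : read i j v w = Some u -> dense_subgroup (t v * ev w / t u).
  by move/H; rewrite /= mul1g divg1.
elim: w v u => [|l w IHw] v u /=.
  by case=> ->; rewrite /weval big_nil mulg1 mulgV; case: hH.
case vl: (step i j v l) => [p|] //= /IHw pw.
rewrite weval_cons.
have -> : t v * (lev l * ev w) / t u =
    (t v * lev l / t p) * (t p * ev w / t u).
  by rewrite !mulgA mulgVK.
apply: (is_subgroupM hH) => //.
case: l vl => k s; rewrite /step /leval /=.
have HaV := is_subgroupV hH Ha; have HbV := is_subgroupV hH Hb.
have H1 : dense_subgroup 1 by case: hH.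
case: eqP => [-> | _]; last case: eqP => [-> | //].
- by case: s v => [] [|[|[|v]]] //= [<-] /=;
     rewrite -/a ?mul1g ?divg1 ?mulgK ?mulgV.
- case: s v => [] [|[|[|v]]] //= [<-] /=; rewrite -/b ?mul1g ?divg1 ?mulgV //.
  by move: HbV; rewrite !invgM !invgK !mulgA.
Qed.

Lemma dense_subgroupP w :
  dense_subgroup (ev w) <-> read i j 0 (reduction w) = Some 0.
Proof.
split=> [/dense_subgroup_read[u /weval_eq_reduction <-] | ].
  exact: read_reduction.
by move/read_dense_subgroup; rewrite weval_reduction.
Qed.

Lemma isolated_dense_subgroup : isolated dense_subgroup.
Proof.
move=> g n n_gt0; have [w0 <-] := weval_surj g.
rewrite -weval_reduction; have := reduced_reduction w0.
have [u [[|l c] [-> lc]]] := cyclic_reduction (reduction w0).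
  (* An empty cyclic core means that the element is 1, which equals all its powers. *)
  by rewrite weval_cat weval_inv mulgV expg1n.
move=> redw; have -> : ev (u ++ (l :: c) ++ winv u) ^+ n =
    ev (u ++ flatten (nseq n (l :: c)) ++ winv u).
  rewrite !weval_cat weval_pow weval_inv !mulgA.
  have := conjXg (ev (l :: c)) (ev u)^-1 n.
  by rewrite !conjgE !invgK !mulgA.
case: n n_gt0 => // n _; rewrite !dense_subgroupP.
rewrite !reduction_id //; last exact: reduced_conj_pow.
exact: isolated_read.
Qed.

(** The one-letter word for [b] leads from vertex 0 to vertex 1. *)
Lemma dense_subgroup_proper : ~ dense_subgroup b.
Proof.
have -> : b = ev [:: (j, false)] by rewrite /weval big_seq1.
rewrite dense_subgroupP /= /step /= eqxx.
by have /eqP/negPf -> : j <> i by move/esym.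
Qed.

Lemma dense_subgroup_image (Q : groupType) (phi : UMagmaMorphism.type F Q) :
  nilpotent Q -> (phi @` dense_subgroup) (phi b).
Proof.
move=> nilQ; apply: (@nilpotent_conj_mem _ _ (phi a)) => //.
- exact/is_subgroup_image/is_subgroup_generated.
- by exists a => //; apply: sub_generated; left.
- exists ((b * a) * b / (b * a)); first by apply: sub_generated; right.
  by rewrite gmulfF !gmulfM.
Qed.

End TwoGenerators.

End FreeGroup.

Theorem mainTheorem1 (F : groupType) (B : set F) (hB : free_on B)
    (hrank : exists a b : F, B a /\ B b /\ a <> b) :
  exists H : set F,
    is_subgroup H /\ finitely_generated H /\ isolated H /\
    ~ separable_in nilpotent H.
Proof.
have [a [b [Ba [Bb ab]]]] := hrank.
pose i : set_type B := exist _ a (mem_set Ba).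
pose j : set_type B := exist _ b (mem_set Bb).
have neq_ij : i <> j by move/(congr1 val).
exists (dense_subgroup i j); split; first exact: is_subgroup_generated.
split; first by exists [set a; (b * a) * b / (b * a)]; first exact: finite_set2.
split; first exact: isolated_dense_subgroup.
move=> /(_ _ (dense_subgroup_proper hB neq_ij))[Q [phi [nilQ]]]; apply.
exact: dense_subgroup_image.
Qed.
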